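(* Let $\hat{\bm x}$ be the penalized maximum likelihood estimator with regularization parameters $\rho_1,\rho_2\ge0$, $\hat M = M(\hat{\bm x})$, and $\widehat{err}$ the link prediction error, in the multi-relational network model described in the context. Let the number of entities $N \to \infty$ and let $C, K, U, d_E, d_R, \alpha, \gamma$ be absolute constants (not depending on $N$). Assume that $\bm x^* \in \Theta = \mathcal{E}^N \times \mathcal{R}^K$, where $\mathcal{E}$ and $\mathcal{R}$ are Euclidean balls of radius $U$ centered at $\bm 0$; that $|\phi(\bm u) - \phi(\bm v)| \le \alpha \|\bm u - \bm v\|$ for all $\bm u, \bm v \in \mathcal{E}^2 \times \mathcal{R}$; that $\rho_1+\rho_2 = o(\log N)$; and that there exists $\varepsilon>0$ (not depending on $N$) such that $\left|M^*_\lambda-\frac12\right|\ge\varepsilon$ for every $\lambda\in\Lambda$. Then: (i) If $t>0$ is a fixed constant, $$\log P\left(\widehat{err} \geq t\right) \lesssim - \frac{2\varepsilon^2t}{5C}\,n.$$ (ii) If $t = \frac{5C}{\varepsilon^2} \frac{m}{n} \log \frac{n}{m}$, $$\log P\left(\widehat{err}\geq t\right) \lesssim - m \log \frac{n}{m}.$$ (iii) Furthermore, $$E\left[\widehat{err}\right] \lesssim \frac{5C}{\varepsilon^2}\, \frac{m}{n} \log \frac{n}{m}.$$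
   Context: Notation: $[N]=\{1,\dots,N\}$; $\sigma(x) = e^x/(1+e^x)$; $\mathrm{sgn}(x) = 1$ for $x\ge0$ and $0$ otherwise; $1_A$ is the indicator of $A$; $\|\cdot\|$ is the Euclidean norm and $\|\cdot\|_1$ the $L_1$ norm. For positive sequences, $a \lesssim b$ means $\limsup_{N\to\infty} a/b \le 1$; for negative sequences, $a \lesssim b$ means $\liminf_{N\to\infty} a/b \ge 1$. Model: There are $N$ entities and $K$ relations; $\Lambda = [N]\times[N]\times[K]$ is the set of edges. $\mathcal{E}\subset\mathbb{R}^{d_E}$ and $\mathcal{R}\subset\mathbb{R}^{d_R}$ are compact sets, $\Theta = \mathcal{E}^N\times\mathcal{R}^K$, and elements of $\Theta$ are written $\bm x = (\bm\theta_1,\dots,\bm\theta_N,\bm w_1,\dots,\bm w_K)$. For $\lambda=(i,j,k)\in\Lambda$ put $\bm x_\lambda = (\bm\theta_i,\bm\theta_j,\bm w_k)$. Given a score function $\phi:\mathcal{E}^2\times\mathcal{R}\to\mathbb{R}$, let $M_\lambda(\bm x) = \sigma(\phi(\bm x_\lambda))$ and $M(\bm x) = (M_\lambda(\bm x))_{\lambda\in\Lambda}$. The true parameter is $\bm x^*$, $M^* = M(\bm x^* )$, and the $Y_\lambda$, $\lambda\in\Lambda$, are independent Bernoulli$(M^*_\lambda)$ variables. Each edge is observed independently with probability $\gamma\in(0,1]$, independently of $Y$; $\mathcal{S}\subset\Lambda$ is the random set of observed edges. Put $n = \gamma N^2 K$, $m = N d_E + K d_R$, and $C = \sup_{\bm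 u\in\mathcal{E}^2\times\mathcal{R}}|\phi(\bm u)|$; it is assumed throughout that $C\ge 2$. Estimator: the log-likelihood is $l(\bm x;Y_{\mathcal{S}}) = \sum_{\lambda\in\mathcal{S}} \big[Y_\lambda\log M_\lambda(\bm x) + (1-Y_\lambda)\log(1-M_\lambda(\bm x))\big]$ and the penalized log-likelihood is $l_\rho(\bm x;Y_{\mathcal{S}}) = l(\bm x;Y_{\mathcal{S}}) - \rho_1\|\bm x\|_1 - \rho_2\|\bm x\|^2$, where $\rho_1,\rho_2\ge 0$ may depend on $N$. The penalized maximum likelihood estimator $\hat{\bm x}$ is a maximizer of $l_\rho(\bm x;Y_{\mathcal{S}})$ over $\bm x\in\Theta$ (not necessarily unique). Loss: $\widehat{err} = \frac{1}{|\Lambda|}\sum_{\lambda\in\Lambda}1_{\hat Y_\lambda\ne Y^*_\lambda}$, where $\hat Y_\lambda = \mathrm{sgn}(\hat M_\lambda-\frac12)$ and $Y^*_\lambda = \mathrm{sgn}(M^*_\lambda-\frac12)$. *)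

(* Defs.v *)
From HB Require Import structures.
From mathcomp Require Export all_boot all_order all_algebra.
From mathcomp Require Export all_classical all_reals all_analysis.
Export Order.TTheory GRing.Theory Num.Theory.
Export numFieldNormedType.Exports.

Set Implicit Arguments.
Unset Strict Implicit.
Unset Printing Implicit Defensive.

Local Open Scope classical_set_scope.
Local Open Scope ring_scope.

Section Euclidean.
Variable R : realType.

(* The norm that the library puts on 'rV[R]_n is the sup norm. *)
Definition enorm (n : nat) (v : 'rV[R]_n) : R :=
  Num.sqrt (\sum_(i < n) v ord0 i ^+ 2).

Definition eball (n : nat) (U : R) : set 'rV[R]_n := [set v | enorm v <= U].

Definition logistic (x : R) : R := expR x / (1 + expR x).

(* The value 1 is [true] and the value 0 is [false]. *)
Definition sgn01 (x : R) : bool := 0 <= x.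

End Euclidean.

Arguments eball {R} n U.

Definition edge (N K : nat) : finType := ('I_N * 'I_N * 'I_K)%type.

Section Network.
Variables (R : realType) (N K dE dR : nat).

(* Row i of the first matrix is theta_i, row k of the second one is w_k. *)
Definition param : Type := ('M[R]_(N, dE) * 'M[R]_(K, dR))%type.

Definition param_space (E : set 'rV[R]_dE) (W : set 'rV[R]_dR) : set param :=
  [set x | (forall i, E (row i x.1)) /\ (forall k, W (row k x.2))].

Definition norm1 (x : param) : R :=
  \sum_i \sum_j `|x.1 i j| + \sum_k \sum_j `|x.2 k j|.

Definition sqnorm (x : param) : R :=
  \sum_i \sum_j x.1 i j ^+ 2 + \sum_k \sum_j x.2 k j ^+ 2.

Definition edge_param (x : param) (l : edge N K) : 'rV[R]_(dE + dE + dR) :=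
  row_mx (row_mx (row l.1.1 x.1) (row l.1.2 x.1)) (row l.2 x.2).

Definition edge_prob (phi : 'rV[R]_(dE + dE + dR) -> R) (x : param)
    (l : edge N K) : R :=
  logistic (phi (edge_param x l)).

Definition loglik (phi : 'rV[R]_(dE + dE + dR) -> R)
    (y : edge N K -> bool) (s : {set edge N K}) (x : param) : R :=
  \sum_(l in s) ((y l)%:R * ln (edge_prob phi x l)
                 + (1 - (y l)%:R) * ln (1 - edge_prob phi x l)).

Definition penalized_loglik (phi : 'rV[R]_(dE + dE + dR) -> R) (rho1 rho2 : R)
    (y : edge N K -> bool) (s : {set edge N K}) (x : param) : R :=
  loglik phi y s x - rho1 * norm1 x - rho2 * sqnorm x.

Definition is_pmle (phi : 'rV[R]_(dE + dE + dR) -> R) (rho1 rho2 : R)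
    (Theta : set param) (y : edge N K -> bool) (s : {set edge N K})
    (xhat : param) : Prop :=
  Theta xhat /\
  forall x, Theta x ->
    penalized_loglik phi rho1 rho2 y s x
      <= penalized_loglik phi rho1 rho2 y s xhat.

Definition link_error (phi : 'rV[R]_(dE + dE + dR) -> R)
    (xstar xhat : param) : R :=
  (#|edge N K|%:R)^-1 *
  \sum_(l : edge N K)
     (sgn01 (edge_prob phi xhat l - 2^-1)
        != sgn01 (edge_prob phi xstar l - 2^-1))%:R.

End Network.

(* The subset E x E x W of R^(dE + dE + dR). *)
Definition edge_space (R : realType) (dE dR : nat)
    (E : set 'rV[R]_dE) (W : set 'rV[R]_dR) : set 'rV[R]_(dE + dE + dR) :=
  [set u | [/\ E (lsubmx (lsubmx u)), E (rsubmx (lsubmx u)) & W (rsubmx u)]].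

Definition mutually_independent (d d' : measure_display) (T : measurableType d)
    (T' : measurableType d') (R : realType) (P : probability T R)
    (I : finType) (X : I -> T -> T') : Prop :=
  forall (J : {set I}) (A : I -> set T'), (forall i, measurable (A i)) ->
    P (\bigcap_(i in [set` J]) (X i @^-1` A i)) =
    (\prod_(i in J) fine (P (X i @^-1` A i)))%:E.

Record sampling_model (d : measure_display) (T : measurableType d)
    (R : realType) (P : probability T R) (N K : nat)
    (Mstar : edge N K -> R) (gamma : R)
    (Y : edge N K -> T -> bool) (S : T -> {set edge N K}) : Prop := {
  sampling_measurable_Y : forall l, measurable_fun setT (Y l);
  sampling_measurable_S : forall l, measurable_fun setT (fun w => l \in S w);
  sampling_prob_Y : forall l, P [set w | Y l w] = (Mstar l)%:E;
  sampling_prob_S : forall l, P [set w | l \in S w] = gamma%:E;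
  (* One joint family: this contains the independence of S from Y. *)
  sampling_independent :
    mutually_independent P
      (fun i : edge N K + edge N K =>
         match i with
         | inl l => Y l
         | inr l => fun w => l \in S w
         end) }.

Section AsymptoticInequality.
Variable R : realType.
Local Open Scope ereal_scope.

(* The left-hand sides are extended, so that log 0 = -oo is allowed. *)
Definition lesssim_pos (a : nat -> \bar R) (b : nat -> R) : Prop :=
  limn_esup (fun N => a N / (b N)%:E) <= 1.

Definition lesssim_neg (a : nat -> \bar R) (b : nat -> R) : Prop :=
  1 <= limn_einf (fun N => a N / (b N)%:E).

End AsymptoticInequality.

(* Main.v *)
(* Tilting the log-likelihood ratio of x against xstar by 1/2 turns its moment
   generating function into a product of Bhattacharyya coefficients.  An edge
   on which x and xstar predict different links contributes at most
   exp(- gamma eps^2 / 2), so that x beats xstar up to a slack a with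
   probability at most exp(a / 2 - n eps^2 err / 2).  A union bound over a grid
   of N^2 + 1 cells per coordinate, with one representative of error at least t
   in each cell that has one (err is not continuous), costs a factor
   exp((2 + o(1)) m log N).  Since C >= 2, the exponent n eps^2 t / 2 exceeds
   the claimed 2 eps^2 t n / (5 C) by a factor at least 5/2, which absorbs the
   grid and the penalty; this is why all three bounds hold eventually without
   any o(1) correction. *)
Require Import Defs.
From mathcomp Require Import measurable_realfun ring lra.
Local Open Scope classical_set_scope.
Local Open Scope ring_scope.

Set Implicit Arguments.
Unset Strict Implicit.
Unset Printing Implicit Defensive.

(** * Logistic function, Bhattacharyya coefficients and the moment generating function of one
    edge *)

Section Logistic.
Variable R : realType.
Implicit Types a b p q : R.

Lemma logistic_gt0 a : 0 < logistic a.
Proof. by rewrite divr_gt0 ?addr_gt0 ?expR_gt0. Qed.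

Lemma onem_logistic a : 1 - logistic a = (1 + expR a)^-1.
Proof. by have := expR_gt0 a; rewrite /logistic => ?; field; lra. Qed.

Lemma logistic_lt1 a : logistic a < 1.
Proof. by rewrite -subr_gt0 onem_logistic invr_gt0 addr_gt0 ?expR_gt0. Qed.

(** The derivative of log sigma is 1 - sigma, which lies in (0,1). Without derivatives: after
    cross-multiplication the claim follows from e^a <= e^b e^|a-b| and e^a e^b <= e^a e^b
    e^|a-b|. *)
Lemma ln_logistic_lip a b : ln (logistic a) <= ln (logistic b) + `|a - b|.
Proof.
rewrite -[`|_|]expRK -lnM ?posrE ?logistic_gt0 ?expR_gt0//.
rewrite ler_ln ?posrE ?mulr_gt0 ?logistic_gt0 ?expR_gt0// /logistic.
have a0 := expR_gt0 a; have b0 := expR_gt0 b.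
have h1 : 1 <= expR `|a - b| by rewrite -expR0 ler_expR.
have hab : expR a <= expR b * expR `|a - b|.
  by rewrite -expRD ler_expR; have := ler_norm (a - b); lra.
rewrite mulrAC ler_pdivlMr; last lra.
rewrite mulrAC ler_pdivrMr; last lra.
have := mulr_ge0 (mulr_ge0 (ltW a0) (ltW b0)) (_ : 0 <= expR `|a - b| - 1).
by rewrite subr_ge0 => /(_ h1); lra.
Qed.

Lemma ln_onem_logistic_lip a b :
  ln (1 - logistic a) <= ln (1 - logistic b) + `|a - b|.
Proof.
have logisticN (c : R) : 1 - logistic c = logistic (- c).
  rewrite onem_logistic /logistic expRN; have := expR_gt0 c => ?.
  by field; rewrite !gt_eqF//; lra.
have -> : `|a - b| = `|- a - - b| by rewrite -opprD normrN.
by rewrite !logisticN ln_logistic_lip.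
Qed.

(** Regrouping pq(1-p)(1-q) as a product of the two Bernoulli variances, AM-GM gives (s + r)^2 <= 1
    - (p - q)^2; then s + r <= (1 + (s + r)^2) / 2. *)
Lemma bhattacharyya_le p q : 0 < p < 1 -> 0 < q < 1 ->
  Num.sqrt (p * q) + Num.sqrt ((1 - p) * (1 - q)) <= 1 - (p - q) ^+ 2 / 2.
Proof.
move=> /andP[p0 p1] /andP[q0 q1].
set s := Num.sqrt (p * q); set r := Num.sqrt _.
have s2 : s ^+ 2 = p * q by rewrite sqr_sqrtr// mulr_ge0// ltW.
have r2 : r ^+ 2 = (1 - p) * (1 - q) by rewrite sqr_sqrtr// mulr_ge0//; lra.
have sr : 2 * (s * r) <= p * (1 - p) + q * (1 - q).
  rewrite /s /r -sqrtrM; last by rewrite mulr_ge0// ltW.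
  have -> : p * q * ((1 - p) * (1 - q)) = (p * (1 - p)) * (q * (1 - q)) by ring.
  rewrite sqrtrM; last by rewrite mulr_ge0//; lra.
  set u := Num.sqrt _; set v := Num.sqrt _.
  have u2 : u ^+ 2 = p * (1 - p) by rewrite sqr_sqrtr// mulr_ge0//; lra.
  have v2 : v ^+ 2 = q * (1 - q) by rewrite sqr_sqrtr// mulr_ge0//; lra.
  by rewrite -u2 -v2; have := sqr_ge0 (u - v); lra.
have := sqr_ge0 (s + r - 1); lra.
Qed.

(** The exponential is (p/q)^(1/2): tilting by 1/2 turns a likelihood under the true parameter into
    a summand of the Bhattacharyya coefficient. *)
Lemma mul_expR_half_lnB p q : 0 < p -> 0 < q ->
  q * expR ((ln p - ln q) / 2) = Num.sqrt (p * q).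
Proof.
move=> p0 q0; apply/eqP; rewrite -(@eqrXn2 _ 2) ?sqrtr_ge0//; last first.
  by rewrite mulr_ge0 ?expR_ge0// ltW.
rewrite sqr_sqrtr; last by rewrite mulr_ge0// ltW.
have -> : (q * expR ((ln p - ln q) / 2)) ^+ 2
          = q ^+ 2 * (expR ((ln p - ln q) / 2) * expR ((ln p - ln q) / 2)).
  by ring.
rewrite -expRD -splitr expRD expRN !lnK ?posrE//.
by apply/eqP; field; rewrite gt_eqF.
Qed.

Definition bern p (b : bool) : R := if b then p else 1 - p.

Definition bern_lik p (b : bool) : R := b%:R * ln p + (1 - b%:R) * ln (1 - p).

(** An unobserved edge contributes 1 - gamma and an observed one gamma times the Bhattacharyya
    coefficient; 1 - x <= exp(-x) bounds the total. *)
Lemma bern_mgf p q gamma : 0 < p < 1 -> 0 < q < 1 -> 0 <= gamma ->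
  \sum_(c : bool * bool) bern q c.1 * bern gamma c.2 *
     expR (c.2%:R * (bern_lik p c.1 - bern_lik q c.1) / 2)
  <= expR (- (gamma * (p - q) ^+ 2 / 2)).
Proof.
move=> p01 q01 g0.
rewrite -(pair_bigA _ (fun a b : bool => bern q a * bern gamma b *
   expR (b%:R * (bern_lik p a - bern_lik q a) / 2)))/=.
rewrite !big_bool/= /bern/= /bern_lik/=.
rewrite !(mul0r, mul1r, subrr, subr0, add0r, addr0) expR0 !mulr1.
have := bhattacharyya_le p01 q01.
move: p01 q01 => /andP[p0 p1] /andP[q0 q1].
rewrite -mul_expR_half_lnB// -(@mul_expR_half_lnB (1 - p)); [|lra|lra].
set u := expR _; set v := expR _ => hb.
apply: le_trans (expR_ge1Dx _).
have := ler_wpM2l g0 hb; lra.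
Qed.

End Logistic.

Lemma measure_fin_union_bound (d : measure_display) (T : measurableType d)
    (R : realType) (P : probability T R) (I : finType) (Q : pred I)
    (F : set T) (A : I -> set T) :
  measurable F -> (forall i, Q i -> measurable (A i)) ->
  (forall w, F w -> exists2 i, Q i & A i w) ->
  (P F <= \sum_(i | Q i) P (A i))%E.
Proof.
move=> mF mA FA.
have := @content_sub_fsum _ _ _ P I [set` Q] F A.
rewrite -(@bigfs _ _ _ _ (index_enum I)) ?index_enum_uniq//; last first.
  by move=> i _; rewrite mem_index_enum.
by apply=> // w /FA[i Qi Aiw]; exists i.
Qed.

(** * Law of the observed data and an exponential Markov inequality *)

Section SamplingChernoff.
Context (d : measure_display) (T : measurableType d) (R : realType).
Variables (P : probability T R) (N K : nat) (M : edge N K -> R) (gamma : R).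
Variables (Y : edge N K -> T -> bool) (S : T -> {set edge N K}).
Hypothesis sampling : sampling_model P M gamma Y S.

(** All the randomness that enters the likelihood, as a point of a finite type: events of the data
    become finite unions of atoms, hence measurable, and expectations become finite sums. *)
Definition outcome (w : T) : {ffun edge N K -> bool * bool} :=
  [ffun l => (Y l w, l \in S w)].

Lemma measurable_bool_eq (X : T -> bool) b :
  measurable_fun setT X -> measurable (X @^-1` [set b]).
Proof. by move=> mX; rewrite -[_ @^-1` _]setTI; exact: mX. Qed.

Lemma bern_prob (X : T -> bool) p b : measurable_fun setT X ->
  P [set w | X w] = p%:E -> P (X @^-1` [set b]) = (bern p b)%:E.
Proof.
move=> mX Pp; case: b => /=; first exact: Pp.
have -> : X @^-1` [set false] = ~` (X @^-1` [set true]).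
  by apply/seteqP; split => w /=; case: (X w).
rewrite probability_setC; last exact: measurable_bool_eq.
by rewrite [P _]Pp EFinB.
Qed.

Lemma measurable_outcome c : measurable (outcome @^-1` [set c]).
Proof.
have -> : outcome @^-1` [set c] = \bigcap_(l in [set: edge N K])
    (Y l @^-1` [set (c l).1] `&` (fun w => l \in S w) @^-1` [set (c l).2]).
  apply/seteqP; split=> w /=.
    by move=> <- l _ /=; rewrite ffunE.
  move=> h; apply/ffunP => l; rewrite ffunE; have [] := h l I.
  by case: (c l) => ? ? /= -> ->.
apply: fin_bigcap_measurable => [|l _]; first exact: finite_finset.
apply: measurableI; apply: measurable_bool_eq.
- exact: sampling_measurable_Y sampling _.
- exact: sampling_measurable_S sampling _.
Qed.

Lemma outcome_prob c : P (outcome @^-1` [set c]) =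
  (\prod_l (bern (M l) (c l).1 * bern gamma (c l).2))%:E.
Proof.
have := @sampling_independent _ _ _ _ _ _ _ _ _ _ sampling
  [set: edge N K + edge N K]%SET (fun i => match i with
     | inl l => [set (c l).1] | inr l => [set (c l).2] end).
set lhs := P (bigcap _ _) => h.
have -> : P (outcome @^-1` [set c]) = lhs.
  congr (P _); apply/seteqP; split=> w /=.
    by move=> <- [l|l] _ /=; rewrite ffunE.
  move=> hw; apply/ffunP => l; rewrite ffunE.
  have inT i : [set` [set: edge N K + edge N K]%SET] i by rewrite /= inE.
  have /= -> := hw (inl l) (inT _); have /= -> := hw (inr l) (inT _).
  by case: (c l).
rewrite {}h; last by case.
congr (_%:E); under eq_bigl do rewrite inE.
rewrite big_sumType big_split/=.
congr (_ * _); apply: eq_bigr => l _.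
- by rewrite (bern_prob _ (sampling_measurable_Y sampling l)
    (sampling_prob_Y sampling l)).
- by rewrite (bern_prob _ (sampling_measurable_S sampling l)
    (sampling_prob_S sampling l)).
Qed.

Lemma measurable_outcome_pred (Q : {ffun edge N K -> bool * bool} -> Prop) :
  measurable [set w | Q (outcome w)].
Proof.
have -> : [set w | Q (outcome w)] = \bigcup_(c in Q) (outcome @^-1` [set c]).
  apply/seteqP; split=> w /=; first by move=> Qw; exists (outcome w).
  by move=> [c Qc /= ->].
apply: fin_bigcup_measurable => [|c _]; first exact: finite_finset.
exact: measurable_outcome.
Qed.

Hypothesis M01 : forall l, 0 < M l < 1.
Hypothesis gamma01 : 0 <= gamma <= 1.

Lemma bern_ge0 (p : R) b : 0 <= p <= 1 -> 0 <= bern p b.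
Proof. by case: b => /= /andP[]; lra. Qed.

(** On [F] the weight exp(a + sum of the [h l]) is at least 1, and independence of the edges factors
    its expectation. *)
Lemma outcome_markov (F : set T) (a : R) (h : edge N K -> bool * bool -> R) :
  measurable F ->
  (forall w, F w -> 0 <= a + \sum_l h l (outcome w l)) ->
  (P F <= (expR a * \prod_l \sum_(c : bool * bool)
             bern (M l) c.1 * bern gamma c.2 * expR (h l c))%:E)%E.
Proof.
move=> mF hF.
pose Q (c : {ffun edge N K -> bool * bool}) := 0 <= a + \sum_l h l (c l).
apply: (@le_trans _ _ (\sum_(c | Q c) P (outcome @^-1` [set c]))%E).
  apply: measure_fin_union_bound => // [c _|w Fw].
    exact: measurable_outcome.
  by exists (outcome w) => //; exact: hF.
rewrite (eq_bigr _ (fun c _ => outcome_prob c)).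
(* Distributivity expands the product over edges into a sum over all outcomes. Its terms are
   nonnegative, so those outside [Q] only increase the right-hand side. *)
rewrite sumEFin lee_fin bigA_distr_bigA/= mulr_sumr [leLHS]big_mkcond/=.
apply: ler_sum => c _; rewrite [X in _ * X]big_split/= mulrCA -expR_sum -expRD.
have w0 : 0 <= \prod_l (bern (M l) (c l).1 * bern gamma (c l).2).
  apply: prodr_ge0 => l _; rewrite mulr_ge0// bern_ge0//.
  by case/andP: (M01 l) => *; rewrite !ltW.
case: ifPn => [Qc|_]; last by rewrite mulr_ge0// expR_ge0.
by rewrite ler_peMr// -expR0 ler_expR.
Qed.

End SamplingChernoff.

(** * Coordinate bounds for the Euclidean norm, and the grid on an interval *)

Section EuclideanNorm.
Variable R : realType.

Lemma enorm_coord n (v : 'rV[R]_n) j : `|v ord0 j| <= enorm v.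
Proof.
rewrite -sqrtr_sqr ler_wsqrtr// (bigD1 j)//= lerDl.
by apply: sumr_ge0 => i _; exact: sqr_ge0.
Qed.

(** The sharp factor is sqrt n; the cruder n follows from n <= n^2 and only affects constants. *)
Lemma enorm_le n (v : 'rV[R]_n) r : 0 <= r -> (forall j, `|v ord0 j| <= r) ->
  enorm v <= n%:R * r.
Proof.
move=> r0 vr; have nr0 : 0 <= n%:R * r by rewrite mulr_ge0.
rewrite -[leRHS]ger0_norm// -sqrtr_sqr ler_wsqrtr//.
apply: (@le_trans _ _ (\sum_(i < n) r ^+ 2)).
  apply: ler_sum => i _; rewrite -[leLHS]real_normK ?num_real//.
  by rewrite lerXn2r ?nnegrE.
rewrite sumr_const card_ord -[leLHS]mulr_natl exprMn ler_wpM2r ?sqr_ge0//.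
by rewrite -natrX ler_nat; case: (n) => // k; rewrite leq_pmulr.
Qed.

End EuclideanNorm.

(** Rescale [-U, U] to [0, q] and round down. The endpoint a = U is sent to q itself, whence q + 1
    cells. *)
Lemma grid_cell (R : realType) (U : R) (q : nat) : 0 < U -> (0 < q)%N ->
  exists f : R -> 'I_q.+1, forall a b, `|a| <= U -> `|b| <= U ->
    f a = f b -> `|a - b| <= 2 * U / q%:R.
Proof.
move=> U0 q0; have q0' : 0 < q%:R :> R by rewrite ltr0n.
pose g (a : R) := (a + U) / (2 * U) * q%:R.
exists (fun a => inord (Num.truncn (g a))).
have gP a : `|a| <= U -> 0 <= g a /\ g a <= q%:R.
  rewrite ler_norml => /andP[a1 a2]; split.
    by apply: mulr_ge0; [apply: divr_ge0; lra|exact: ltW].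
  by rewrite ler_piMl ?(ltW q0')// ler_pdivrMr; lra.
move=> a b /gP[ga0 ga1] /gP[gb0 gb1] /(congr1 val)/=.
rewrite !inordK ?ltnS; last 2 first.
- by rewrite -(ler_nat R) (le_trans _ gb1)// truncn_le.
- by rewrite -(ler_nat R) (le_trans _ ga1)// truncn_le.
move=> gab; have /andP[a1 a2] := truncn_itv ga0; have /andP[] := truncn_itv gb0.
rewrite -gab => b1 b2.
have -> : a - b = (g a - g b) * (2 * U / q%:R) by rewrite /g; field; lra.
have h0 : 0 <= 2 * U / q%:R by apply: divr_ge0; lra.
rewrite normrM (ger0_norm h0) ler_piMl// ler_norml.
by move: a2 b2; rewrite -natr1; lra.
Qed.

(** * Prediction error, penalty and likelihood of a fixed parameter *)

Section LinkError.
Context (R : realType) (N K dE dR : nat).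
Variable phi : 'rV[R]_(dE + dE + dR) -> R.
Implicit Types x z : param R N K dE dR.

Lemma card_edge : #|edge N K|%:R = N%:R ^+ 2 * K%:R :> R.
Proof. by rewrite !card_prod !card_ord !natrM expr2. Qed.

Lemma link_errorE z x : #|edge N K|%:R * link_error phi z x =
  \sum_(l : edge N K) (sgn01 (edge_prob phi x l - 2^-1)
    != sgn01 (edge_prob phi z l - 2^-1))%:R.
Proof.
rewrite /link_error; have [c0|c0] := posnP #|edge N K|.
  by rewrite c0 mul0r big1// => l; have := fintype0 l c0.
by rewrite mulrA divff ?mul1r// pnatr_eq0 -lt0n.
Qed.

Lemma link_error_ge0 z x : 0 <= link_error phi z x.
Proof. by rewrite mulr_ge0 ?invr_ge0// sumr_ge0. Qed.

Lemma link_error_le1 z x : link_error phi z x <= 1.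
Proof.
have [c0|c0] := posnP #|edge N K|; first by rewrite /link_error c0 invr0 mul0r.
rewrite -(ler_pM2l (_ : 0 < #|edge N K|%:R)) ?ltr0n// link_errorE mulr1.
rewrite -sum1_card natr_sum; apply: ler_sum => l _.
by rewrite lern1; case: (_ != _).
Qed.

Lemma loglikE (y : edge N K -> bool) (s : {set edge N K}) x :
  loglik phi y s x = \sum_l (l \in s)%:R * bern_lik (edge_prob phi x l) (y l).
Proof.
rewrite /loglik big_mkcond/=; apply: eq_bigr => l _.
by case: ifP; rewrite ?mul1r ?mul0r.
Qed.

Lemma edge_prob01 x l : 0 < edge_prob phi x l < 1.
Proof. by rewrite logistic_gt0 logistic_lt1. Qed.

(** Predictions differ only if p and q lie on opposite sides of 1/2, and then |p - q| is at least
    the distance from q to 1/2. *)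
Lemma sgn01_gap (e p q : R) : e <= `|q - 2^-1| -> 0 <= e ->
  sgn01 (p - 2^-1) != sgn01 (q - 2^-1) -> e ^+ 2 <= (p - q) ^+ 2.
Proof.
rewrite /sgn01 => qe e0; case: (lerP 0 (p - _)); case: (lerP 0 (q - _)) => //.
- move=> q0 p0 _; move: qe; rewrite ltr0_norm// => qe.
  by rewrite lerXn2r ?nnegrE//; lra.
- move=> q0 p0 _; move: qe; rewrite ger0_norm// => qe.
  by rewrite -[leRHS]sqrrN lerXn2r ?nnegrE//; lra.
Qed.

Lemma param_entries U x : param_space (eball dE U) (eball dR U) x ->
  (forall i j, `|x.1 i j| <= U) /\ (forall k j, `|x.2 k j| <= U).
Proof.
move=> [x1 x2]; split=> [i j|k j].
- by apply: le_trans (x1 i); have := enorm_coord (row i x.1) j; rewrite mxE.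
- by apply: le_trans (x2 k); have := enorm_coord (row k x.2) j; rewrite mxE.
Qed.

Lemma sum_entries_le (f : 'I_N -> 'I_dE -> R) (g : 'I_K -> 'I_dR -> R) c :
  (forall i j, f i j <= c) -> (forall k j, g k j <= c) ->
  \sum_i \sum_j f i j + \sum_k \sum_j g k j <= (N * dE + K * dR)%:R * c.
Proof.
move=> fc gc; rewrite natrD mulrDl !natrM lerD// -!mulrA.
- rewrite mulr_natl -[in leRHS](card_ord N) -sumr_const ler_sum// => i _.
  by rewrite mulr_natl -[in leRHS](card_ord dE) -sumr_const ler_sum.
- rewrite mulr_natl -[in leRHS](card_ord K) -sumr_const ler_sum// => k _.
  by rewrite mulr_natl -[in leRHS](card_ord dR) -sumr_const ler_sum.
Qed.

(** [U + U ^+ 2] dominates both the absolute value and the square of an entry, so one constant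
    serves both penalties. *)
Lemma penalty_le U rho1 rho2 x : 0 <= rho1 -> 0 <= rho2 -> 0 <= U ->
  param_space (eball dE U) (eball dR U) x ->
  rho1 * norm1 x + rho2 * sqnorm x
    <= (rho1 + rho2) * ((N * dE + K * dR)%:R * (U + U ^+ 2)).
Proof.
move=> r1 r2 U0 /param_entries[x1 x2].
have UU : U <= U + U ^+ 2 by rewrite lerDl sqr_ge0.
have sqU a : `|a| <= U -> a ^+ 2 <= U + U ^+ 2.
  move=> aU; rewrite -real_normK ?num_real//.
  by apply: (@le_trans _ _ (U ^+ 2)); [rewrite lerXn2r ?nnegrE|rewrite lerDr].
rewrite mulrDl lerD// ler_wpM2l//; apply: sum_entries_le => i j.
- exact: le_trans UU.
- exact: le_trans UU.
- exact: sqU.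
- exact: sqU.
Qed.

Lemma edge_param_space U x l : param_space (eball dE U) (eball dR U) x ->
  edge_space (eball dE U) (eball dR U) (edge_param x l).
Proof. by move=> [x1 x2]; split; rewrite !(row_mxKl, row_mxKr). Qed.

Lemma edge_param_close (r : R) x z l : 0 <= r ->
  (forall i j, `|x.1 i j - z.1 i j| <= r) ->
  (forall k j, `|x.2 k j - z.2 k j| <= r) ->
  enorm (edge_param x l - edge_param z l) <= (dE + dE + dR)%:R * r.
Proof.
move=> r0 h1 h2; apply: enorm_le => // j.
rewrite /edge_param !opp_row_mx !add_row_mx mxE.
case: (fintype.split j) => [j1|j2]; last by rewrite !mxE.
by rewrite mxE; case: (fintype.split j1) => ?; rewrite !mxE.
Qed.

Lemma bern_lik_lip (a b : R) c :
  bern_lik (logistic a) c <= bern_lik (logistic b) c + `|a - b|.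
Proof.
rewrite /bern_lik; case: c; rewrite !(mul1r, mul0r, subrr, subr0, add0r, addr0).
- exact: ln_logistic_lip.
- exact: ln_onem_logistic_lip.
Qed.

Lemma loglik_lip (y : edge N K -> bool) s x z (r : R) : 0 <= r ->
  (forall l, `|phi (edge_param x l) - phi (edge_param z l)| <= r) ->
  loglik phi y s x <= loglik phi y s z + #|edge N K|%:R * r.
Proof.
move=> r0 xz; rewrite !loglikE mulr_natl -sumr_const -big_split/=.
apply: ler_sum => l _; case: (l \in s) => /=; rewrite ?mul1r ?mul0r ?add0r//.
by apply: le_trans (bern_lik_lip _ (phi (edge_param z l)) _) _; rewrite lerD2l.
Qed.

(** Exponential Markov with half the log-likelihood ratio as exponent: by [sgn01_gap] each wrongly
    predicted edge gains a factor exp(- gamma eps^2 / 2), and every other edge a factor at most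
    1. *)
Lemma loglik_tail (d : measure_display) (T : measurableType d)
    (P : probability T R) gamma eps z x (a : R)
    (Y : edge N K -> T -> bool) (S : T -> {set edge N K}) (F : set T) :
  0 <= gamma <= 1 -> 0 <= eps ->
  (forall l, eps <= `|edge_prob phi z l - 2^-1|) ->
  sampling_model P (edge_prob phi z) gamma Y S ->
  measurable F ->
  (forall w, F w -> loglik phi (Y^~ w) (S w) z - a
                      <= loglik phi (Y^~ w) (S w) x) ->
  (P F <= (expR (a / 2 - gamma * eps ^+ 2 / 2
                 * (#|edge N K|%:R * link_error phi z x)))%:E)%E.
Proof.
move=> g01 e0 zeps smp mF hF.
pose h l (c : bool * bool) := c.2%:R *
  (bern_lik (edge_prob phi x l) c.1 - bern_lik (edge_prob phi z l) c.1) / 2.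
apply: le_trans (outcome_markov (a := a / 2) (h := h) smp (edge_prob01 z)
  g01 mF _) _.
- move=> w /hF; rewrite !loglikE lerBlDr -lerBlDl => hw.
  have -> : \sum_l h l (outcome Y S w l) = (\sum_l (l \in S w)%:R * bern_lik
      (edge_prob phi x l) (Y l w) - \sum_l (l \in S w)%:R * bern_lik
      (edge_prob phi z l) (Y l w)) / 2.
    rewrite -sumrB mulr_suml; apply: eq_bigr => l _.
    by rewrite /h ffunE/= mulrBr.
  by move: hw; lra.
- rewrite lee_fin expRD ler_wpM2l ?expR_ge0// link_errorE -mulNr mulr_sumr.
  rewrite expR_sum; apply: ler_prod => l _; apply/andP; split.
    apply: sumr_ge0 => c _; rewrite mulr_ge0 ?expR_ge0// mulr_ge0 ?bern_ge0//.
    by case/andP: (edge_prob01 z l) => *; rewrite !ltW.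
  have g0 : 0 <= gamma by case/andP: g01.
  apply: le_trans (bern_mgf (edge_prob01 x l) (edge_prob01 z l) g0) _.
  rewrite ler_expR mulNr lerN2 mulrAC ler_pM2r//.
  case: (boolP (_ != _)) => [/(sgn01_gap (zeps l) e0) gap|_].
    by rewrite mulr1 ler_wpM2l.
  by rewrite mulr0 mulr_ge0// sqr_ge0.
Qed.

End LinkError.

(** Union bound over grid cells for the random [xhat]. In the exponent, the first summand is the
    cost of replacing [xhat] by a representative of its cell, the second the cost of the penalty.
    The resolution [q] stays free, to be balanced later. *)
Lemma link_error_tail (R : realType) (N K dE dR : nat)
    (d : measure_display) (T : measurableType d) (P : probability T R)
    (phi : 'rV[R]_(dE + dE + dR) -> R) (U alpha gamma eps rho1 rho2 t : R)
    (xstar : param R N K dE dR) (Y : edge N K -> T -> bool)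
    (S : T -> {set edge N K}) (xhat : T -> param R N K dE dR) (q : nat) :
  let E := eball dE U in
  let W := eball dR U in
  let err := fun w => link_error phi xstar (xhat w) in
  0 < U -> 0 < gamma <= 1 -> 0 <= eps -> (0 < q)%N ->
  (forall u v, edge_space E W u -> edge_space E W v ->
     `|phi u - phi v| <= alpha * enorm (u - v)) ->
  0 <= rho1 -> 0 <= rho2 ->
  param_space E W xstar ->
  (forall l, eps <= `|edge_prob phi xstar l - 2^-1|) ->
  sampling_model P (edge_prob phi xstar) gamma Y S ->
  (forall w, is_pmle phi rho1 rho2 (param_space E W) (Y^~ w) (S w) (xhat w)) ->
  measurable_fun setT err ->
  (P [set w | (t <= err w)%R] <= (q.+1%:R ^+ (N * dE + K * dR) *
     expR ((#|edge N K|%:R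
              * (`|alpha| * ((dE + dE + dR)%:R * (2 * U / q%:R)))
            + (rho1 + rho2) * ((N * dE + K * dR)%:R * (U + U ^+ 2))) / 2
           - gamma * eps ^+ 2 / 2 * (#|edge N K|%:R * t)))%:E)%E.
Proof.
move=> E W err U0 /andP[g0 g1] e0 q0 lip r1 r2 xs xseps smp mle merr.
have [f fP] := grid_cell U0 q0.
(* [r] is the cell width, and [a] the slack by which a representative may fall short of [xstar] in
   likelihood. *)
set r := 2 * U / q%:R; set a := _ + (rho1 + rho2) * _.
have r0 : 0 <= r by rewrite divr_ge0// mulr_ge0// ltW.
pose cell (x : param R N K dE dR) : {ffun 'I_N * 'I_dE + 'I_K * 'I_dR -> 'I_q.+1}
  := [ffun i => match i with
                | inl ij => f (x.1 ij.1 ij.2) | inr kj => f (x.2 kj.1 kj.2) end].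
pose far x := param_space E W x /\ t <= link_error phi xstar x.
pose near_far c := exists2 x, far x & cell x = c.
pose Q c := `[< near_far c >].
(* The representative is itself a parameter of error at least [t], since closeness to [xhat] alone
   would not bound its error. Cells without one get the dummy value [xstar]. *)
have /choice[rep repP] : forall c, exists x, Q c -> far x /\ cell x = c.
  move=> c; have [[x fx xc]|nc] := pselect (near_far c); first by exists x.
  by exists xstar => /asboolP.
have mF x : measurable [set w | loglik phi (Y^~ w) (S w) xstar - a
                                  <= loglik phi (Y^~ w) (S w) x].
  (* The event depends on [w] only through [outcome], which makes it measurable. *)
  pose L (o : {ffun edge N K -> bool * bool}) z :=
    loglik phi (fun l => (o l).1) [set l | (o l).2] z.
  have LE z w : loglik phi (Y^~ w) (S w) z = L (outcome Y S w) z.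
    by rewrite /L !loglikE; apply: eq_bigr => l _; rewrite inE !ffunE.
  rewrite (_ : [set w | _] =
    [set w | L (outcome Y S w) xstar - a <= L (outcome Y S w) x]).
    exact: (measurable_outcome_pred smp (fun o => L o xstar - a <= L o x)).
  by apply/seteqP; split => w /=; rewrite !LE.
have merrt : measurable [set w | t <= err w].
  rewrite (_ : [set w | _] = setT `&` err @^-1` `[t, +oo[).
    by apply: merr.
  by apply/seteqP; split => w /=; rewrite in_itv/= andbT// => -[].
pose G c := [set w | loglik phi (Y^~ w) (S w) xstar - a
                       <= loglik phi (Y^~ w) (S w) (rep c)].
apply: (@le_trans _ _ (\sum_(c | Q c) P (G c))%E).
  apply: measure_fin_union_bound => // [c _|]; first exact: mF.
  move=> w /= tw; have [xw xmax] := mle w; exists (cell (xhat w)).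
    by apply/asboolP; exists (xhat w).
  have Qw : Q (cell (xhat w)) by apply/asboolP; exists (xhat w).
  have [[xr _] cellE] := repP _ Qw; set z := rep _ in xr cellE *.
  have [w1 w2] := param_entries xw; have [z1 z2] := param_entries xr.
  have close l : `|phi (edge_param (xhat w) l) - phi (edge_param z l)|
      <= `|alpha| * ((dE + dE + dR)%:R * r).
    apply: le_trans (lip _ _ (edge_param_space l xw) (edge_param_space l xr)) _.
    apply: (@le_trans _ _ (`|alpha|
        * enorm (edge_param (xhat w) l - edge_param z l))).
      by rewrite ler_wpM2r ?ler_norm// sqrtr_ge0.
    rewrite ler_wpM2l//; apply: edge_param_close => // i j; apply: fP => //.
    - by have /ffunP/(_ (inl (i, j))) := cellE; rewrite !ffunE => /= ->.
    - by have /ffunP/(_ (inr (i, j))) := cellE; rewrite !ffunE => /= ->.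
  have ll := loglik_lip (Y^~ w) (S w)
    (mulr_ge0 (normr_ge0 _) (mulr_ge0 (ler0n _ _) r0)) close.
  (* Chain: penalized likelihood of [xstar], then of [xhat], then likelihood of [z] plus the grid
     error. The penalty of [xhat] is dropped as nonnegative; that of [xstar] goes into [a]. *)
  have := xmax _ xs; rewrite /penalized_loglik.
  have := penalty_le r1 r2 (ltW U0) xs.
  have : 0 <= rho1 * norm1 (xhat w) by rewrite mulr_ge0// addr_ge0//;
    apply: sumr_ge0 => i _; apply: sumr_ge0.
  have : 0 <= rho2 * sqnorm (xhat w) by rewrite mulr_ge0// addr_ge0//;
    apply: sumr_ge0 => i _; apply: sumr_ge0 => j _; exact: sqr_ge0.
  by rewrite /G /= -/z /a; move: ll; lra.
pose b := expR (a / 2 - gamma * eps ^+ 2 / 2 * (#|edge N K|%:R * t)).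
have /le_trans : (\sum_(c | Q c) P (G c) <= \sum_(c | Q c) b%:E)%E.
  apply: lee_sum => c Qc; have [[xr tr] _] := repP _ Qc.
  have g01 : 0 <= gamma <= 1 by rewrite ltW.
  apply: le_trans (loglik_tail g01 e0 xseps smp (mF (rep c)) (fun w h => h)) _.
  rewrite lee_fin ler_expR lerD2l lerN2 ler_wpM2l//.
    by rewrite divr_ge0// mulr_ge0 ?sqr_ge0// ltW.
  by rewrite ler_wpM2l.
apply; rewrite sumEFin lee_fin sumr_const -[leLHS]mulr_natl ler_wpM2r ?expR_ge0//.
apply: (@le_trans _ _ #|{ffun 'I_N * 'I_dE + 'I_K * 'I_dR -> 'I_q.+1}|%:R).
  by rewrite ler_nat max_card.
by rewrite card_ffun card_sum !card_prod !card_ord natrX.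
Qed.

(** * From eventual bounds to limits superior and inferior; logarithms and expectations *)

Section LimitBounds.
Variable R : realType.
Local Open Scope ereal_scope.

Lemma limn_esup_le_near (u : nat -> \bar R) l :
  (\forall N \near \oo, u N <= l) -> limn_esup u <= l.
Proof.
move=> [N0 _ uN]; rewrite limn_esup_lim; apply: lime_le.
  exact: is_cvg_esups.
exists N0 => // N /= N0N; apply: ge_ereal_sup => _ [k /= Nk <-].
by apply: uN => /=; exact: leq_trans Nk.
Qed.

Lemma limn_einf_ge_near (u : nat -> \bar R) l :
  (\forall N \near \oo, l <= u N) -> l <= limn_einf u.
Proof.
move=> lu; rewrite /limn_einf leeNr; apply: limn_esup_le_near.
by apply: filterS lu => N; rewrite leeN2.
Qed.

Lemma lne_div_ge1 (p : \bar R) (b : R) : 0 <= p -> p <= (expR b)%:E ->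
  (b < 0)%R -> 1 <= lne p / b%:E.
Proof.
move=> p0 pb b0; rewrite inver lt_eqF//.
case: p p0 pb => [r| |]//; rewrite !lee_fin => r0 rb.
(* If p = 0, its logarithm -oo divided by the negative [b] is +oo. *)
move: r0; rewrite le_eqVlt => /predU1P[<-|r0].
  by rewrite /= lexx lt0_mulNye ?lte_fin ?invr_lt0// leey.
rewrite lne_EFin// -EFinM lee_fin ler_ndivlMr// mul1r.
by rewrite -[leRHS]expRK ler_ln ?posrE ?expR_gt0.
Qed.

(** Since X <= 1, X is at most a plus the indicator of X >= a. *)
Lemma expectation_le_tail (d : measure_display) (T : measurableType d)
    (P : probability T R) (X : T -> R) (a : R) : measurable_fun setT X ->
  (forall w, 0 <= X w <= 1)%R -> (0 <= a)%R ->
  'E_P[X] <= a%:E + P [set w | (a <= X w)%R].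
Proof.
move=> mX X01 a0; have mA : measurable [set w | (a <= X w)%R].
  rewrite (_ : [set w | _] = setT `&` X @^-1` `[a, +oo[); first exact: mX.
  by apply/seteqP; split => w /=; rewrite in_itv/= andbT// => -[].
rewrite expectation.unlock -(setIT [set w | (a <= X w)%R]) -integral_indic//.
have -> : a%:E = \int[P]_w (cst a%:E) w.
  by rewrite integral_cst//= probability_setT mule1.
rewrite -ge0_integralD//=; last exact/measurable_EFinP/measurable_indic.
apply: ge0_le_integral => //.
- by move=> w _; rewrite lee_fin; case/andP: (X01 w).
- exact/measurable_EFinP.
- by apply: emeasurable_funD => //; exact/measurable_EFinP/measurable_indic.
- move=> w _; rewrite -EFinD lee_fin indicE; case: (lerP a (X w)) => aX.
    by rewrite mem_set//=; case/andP: (X01 w); lra.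
  by rewrite ltW// ltr_wpDr.
Qed.
End LimitBounds.

(** * Growth of n / m and of m log(n / m) *)

Section Rates.
Variables (R : realType) (K dE dR : nat) (gamma : R).
Hypotheses (K0 : (0 < K)%N) (dR0 : (0 < dR)%N) (gamma0 : 0 < gamma).
Let n (N : nat) : R := gamma * N%:R ^+ 2 * K%:R.
Let m (N : nat) : R := (N * dE + K * dR)%:R.
Let kappa : R := gamma * K%:R / (dE + K * dR)%:R.

Lemma dim_ge1 N : 1 <= m N.
Proof. by rewrite ler1n addn_gt0 !muln_gt0 K0 dR0 orbT. Qed.

Lemma rate_gt0 : 0 < kappa.
Proof.
by rewrite divr_gt0 ?mulr_gt0// ltr0n// addn_gt0 muln_gt0 K0 dR0 orbT.
Qed.

(** For N >= 1, N dE + K dR <= N (dE + K dR); [kappa] is the value of n / m at N = 1. *)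
Lemma sample_ratio_ge N : kappa * N%:R <= n N / m N.
Proof.
have m0 := lt_le_trans ltr01 (dim_ge1 N).
have D0 : 0 < (dE + K * dR)%:R :> R.
  by rewrite ltr0n addn_gt0 muln_gt0 K0 dR0 orbT.
rewrite ler_pdivlMr//.
have -> : kappa * N%:R * m N = gamma * K%:R * N%:R * m N / (dE + K * dR)%:R.
  by rewrite /kappa; ring.
rewrite ler_pdivrMr//.
have -> : n N * (dE + K * dR)%:R
    = gamma * K%:R * (N * (N * (dE + K * dR)))%:R by rewrite /n !natrM; ring.
rewrite -mulrA ler_wpM2l ?mulr_ge0 ?(ltW gamma0)// /m -natrM ler_nat.
by rewrite leq_mul2l mulnDr; case: (N) => // k; rewrite leq_add2l leq_pmull.
Qed.

Lemma near_ln_ge (A : R) : \forall N \near \oo, A <= ln (N%:R : R).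
Proof.
exists (Num.truncn (expR A)).+1 => // N /= hN.
rewrite -[A]expRK ler_ln ?posrE ?expR_gt0//.
- apply: le_trans (ltW (truncnS_gt _)) _; rewrite ?ler_nat//.
- by rewrite ltr0n (leq_trans _ hN).
Qed.

Lemma near_sample_ratio_ge (B : R) : \forall N \near \oo, B <= n N / m N.
Proof.
have B0 : 0 < `|B| + 1 by rewrite ltr_wpDl.
near=> N.
have N0 : 0 < N%:R :> R by rewrite ltr0n; near: N; exists 1%N.
apply: le_trans (sample_ratio_ge N).
have : ln ((`|B| + 1) / kappa) <= ln (N%:R : R) by near: N; exact: near_ln_ge.
have k0 := rate_gt0; have B1 : 0 < (`|B| + 1) / kappa by exact: divr_gt0.
rewrite ler_ln ?posrE// ler_pdivrMr// mulrC.
by have := ler_norm B; lra.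
Unshelve. all: by end_near. Qed.

Lemma ln_sample_ratio_ge N : (0 < N)%N ->
  ln N%:R + ln kappa <= ln (n N / m N).
Proof.
move=> N0; have N0' : 0 < N%:R :> R by rewrite ltr0n.
have kN : 0 < kappa * N%:R by rewrite mulr_gt0 ?rate_gt0.
rewrite addrC -lnM ?posrE ?rate_gt0// ler_ln ?posrE ?sample_ratio_ge//.
exact: lt_le_trans (sample_ratio_ge N).
Qed.

Lemma near_entropy_le (c : R) : 0 < c ->
  \forall N \near \oo, m N * ln (n N / m N) <= c * n N.
Proof.
move=> c0; have c20 : 0 < c / 2 by rewrite divr_gt0.
near=> N.
have m0 := lt_le_trans ltr01 (dim_ge1 N).
have z1 : 1 <= n N / m N by near: N; exact: near_sample_ratio_ge.
(* With z = n / m the goal is ln z <= c z. One half of c z bounds ln(c z / 2); beyond this threshold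
   the other half absorbs - ln(c / 2). *)
have zB : - ln (c / 2) / (c / 2) <= n N / m N.
  by near: N; exact: near_sample_ratio_ge.
rewrite -[X in c * X](divfK (lt0r_neq0 m0)) mulrA [leRHS]mulrC ler_pM2l//.
set z := n N / m N in z1 zB *; have z0 : 0 < z by lra.
have : ln (c / 2) + ln z <= c / 2 * z - 1.
  have /le_ln1Dx : -1 < c / 2 * z - 1 by have := mulr_gt0 c20 z0; lra.
  by rewrite [1 + _]addrC subrK lnM.
by move: zB; rewrite ler_pdivrMr// (mulrC z); lra.
Unshelve. all: by end_near. Qed.

End Rates.

(** * Choice of the grid resolution and derivation of the three bounds *)

Theorem corollary3 (R : realType) (K dE dR : nat) (C U alpha gamma eps : R)
  (d : nat -> measure_display) (T : forall N, measurableType (d N))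
  (P : forall N, probability (T N) R)
  (phi : nat -> 'rV[R]_(dE + dE + dR) -> R)
  (rho1 rho2 : nat -> R)
  (xstar : forall N, param R N K dE dR)
  (Y : forall N, edge N K -> T N -> bool)
  (S : forall N, T N -> {set edge N K})
  (xhat : forall N, T N -> param R N K dE dR) :
  let E := eball dE U in
  let W := eball dR U in
  let n := fun N : nat => gamma * N%:R ^+ 2 * K%:R in
  let m := fun N : nat => (N * dE + K * dR)%:R : R in
  let err := fun N (w : T N) => link_error (phi N) (xstar N) (xhat N w) in
  (0 < K)%N -> (0 < dE)%N -> (0 < dR)%N -> 0 < U ->
  0 < gamma -> gamma <= 1 ->
  2 <= C ->
  (forall N, C = sup [set `|phi N u| | u in edge_space E W]) ->
  (forall N u v, edge_space E W u -> edge_space E W v ->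
     `|phi N u - phi N v| <= alpha * enorm (u - v)) ->
  (forall N, 0 <= rho1 N) -> (forall N, 0 <= rho2 N) ->
  ((fun N => rho1 N + rho2 N) : nat -> R^o)
    =o_\oo ((fun N => ln N%:R) : nat -> R^o) ->
  (forall N, param_space E W (xstar N)) ->
  0 < eps ->
  (forall N l, eps <= `|edge_prob (phi N) (xstar N) l - 2^-1|) ->
  (forall N, sampling_model (P N) (edge_prob (phi N) (xstar N)) gamma
               (Y N) (S N)) ->
  (forall N w, is_pmle (phi N) (rho1 N) (rho2 N) (param_space E W)
                 (fun l => Y N l w) (S N w) (xhat N w)) ->
  (forall N, measurable_fun setT (err N)) ->
  [/\ (forall t : R, 0 < t ->
         lesssim_neg (fun N => lne (P N [set w | t <= err N w]))
                     (fun N => - (2 * eps ^+ 2 * t / (5 * C)) * n N)),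
      (let t := fun N =>
         5 * C / eps ^+ 2 * (m N / n N) * ln (n N / m N) in
       lesssim_neg (fun N => lne (P N [set w | t N <= err N w]))
                   (fun N => - (m N * ln (n N / m N)))) &
      lesssim_pos (fun N => 'E_(P N)[err N])%E
        (fun N => 5 * C / eps ^+ 2 * (m N / n N) * ln (n N / m N))].
Proof.
move=> E W n m err K0 dE0 dR0 U0 g0 g1 C2 _ lip r1 r2 rho xs e0 xseps smp mle
  merr.
pose L N := ln (n N / m N).
have m1 N : 1 <= m N by exact: dim_ge1.
have m0 N : 0 < m N by exact: lt_le_trans (m1 N).
have n0 N : (0 < N)%N -> 0 < n N.
  by move=> N0; rewrite !mulr_gt0 ?exprn_gt0 ?ltr0n.
have e2 : 0 < eps ^+ 2 by rewrite exprn_gt0.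
have C0 : 0 < C by lra.
have near_pos : \forall N \near \oo, (0 < N)%N by exists 1%N.
have near_L A : \forall N \near \oo, A <= L N.
  near=> N; have z0 : expR A <= n N / m N.
    by near: N; exact: near_sample_ratio_ge.
  by rewrite -[A]expRK ler_ln ?posrE ?expR_gt0// (lt_le_trans (expR_gt0 A)).
(* The 3 splits as 2 for the grid, 1/2 for the penalty and 1/2 for all constants. [t] is quantified
   inside, so that it may vary with [N] once the threshold on [N] is fixed. *)
pose tail_bound N := forall t, (P N [set w | (t <= err N w)%R]
  <= (expR (3 * (m N * L N) - eps ^+ 2 / 2 * (n N * t)))%:E)%E.
have tail : \forall N \near \oo, tail_bound N.
  pose kappa : R := gamma * K%:R / (dE + K * dR)%:R.
  (* With q = N^2 the grid error, summed over the N^2 K edges, is this constant, independent of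
     N. *)
  pose c1 := K%:R * `|alpha| * (dE + dE + dR)%:R * (2 * U).
  have c10 : 0 <= c1 by rewrite !mulr_ge0 ?(ltW U0).
  have V0 : 0 < U + U ^+ 2 by rewrite addr_gt0 ?exprn_gt0.
  near=> N => t.
  have N0 : (0 < N)%N by near: N.
  have N0' : 0 < N%:R :> R by rewrite ltr0n.
  have q0 : (0 < N ^ 2)%N by rewrite expn_gt0 N0.
  have g01 : 0 < gamma <= 1 by rewrite g0.
  apply: le_trans (link_error_tail t U0 g01 (ltW e0) q0 (lip N) (r1 N) (r2 N)
    (xs N) (xseps N) (smp N) (mle N) (merr N)) _.
  have q1 : 0 < (N ^ 2).+1%:R :> R by rewrite ltr0n.
  rewrite lee_fin -{1}[(N ^ 2).+1%:R]lnK ?posrE// -expRM_natl -expRD ler_expR.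
  rewrite card_edge -/(m N).
  have -> : N%:R ^+ 2 * K%:R * (`|alpha| * ((dE + dE + dR)%:R
      * (2 * U / (N ^ 2)%:R))) = c1.
    by rewrite natrX /c1; field; rewrite gt_eqF.
  have hq : ln (N ^ 2).+1%:R <= ln 2 + 2 * ln (N%:R : R).
    rewrite mulr_natl -lnXn// -lnM ?posrE ?exprn_gt0//.
    rewrite ler_ln ?posrE ?mulr_gt0 ?exprn_gt0// -natrX -natrM ler_nat.
    by rewrite mul2n -addnn -addn1 leq_add2l.
  have hL : ln (N%:R : R) + ln kappa <= L N by exact: ln_sample_ratio_ge.
  have hA : ln 2 + c1 / 2 - 3 * ln kappa <= ln (N%:R : R) / 2.
    by rewrite ler_pdivlMr//; near: N; exact: near_ln_ge.
  have lnN0 : 0 <= ln (N%:R : R) by rewrite ln_ge0// ler1n.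
  (* The little-o hypothesis, used with the constant 1 / (U + U^2). *)
  have hr : (rho1 N + rho2 N) * (U + U ^+ 2) <= ln (N%:R : R).
    rewrite -ler_pdivlMr// mulrC -[leLHS]ger0_norm ?addr_ge0//.
    rewrite -(ger0_norm lnN0); near: N; move/eqoP: rho; apply.
    by rewrite invr_gt0.
  have h : m N * (ln (N ^ 2).+1%:R + c1 / 2
      + (rho1 N + rho2 N) * (U + U ^+ 2) / 2) <= m N * (3 * L N).
    by rewrite ler_pM2l//; lra.
  (* As m >= 1, the grid error can be charged to every coordinate. *)
  have hc : c1 / 2 <= m N * (c1 / 2) by rewrite ler_peMl// divr_ge0.
  rewrite /n; move: h hc; lra.
split.
- move=> t t0; apply: limn_einf_ge_near.
  (* Three times eps^2 t / 10 leaves eps^2 t / 5 of the exponent eps^2 t / 2, and C >= 2 makes this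
     at least the claimed rate. *)
  have c0 : 0 < eps ^+ 2 * t / 10 by rewrite divr_gt0 ?mulr_gt0.
  near=> N.
  have N0 : (0 < N)%N by near: N.
  have tN : tail_bound N by near: N; exact: tail.
  have hC : 2 * eps ^+ 2 * t / (5 * C) <= eps ^+ 2 * t / 5.
    by rewrite ler_pdivrMr ?mulr_gt0//; have := mulr_gt0 e2 t0; nra.
  apply: lne_div_ge1 => //.
    apply: (le_trans (tN _)); rewrite lee_fin ler_expR.
    have : m N * L N <= eps ^+ 2 * t / 10 * n N.
      by near: N; exact: (near_entropy_le dE K0 dR0 g0 c0).
    by have := ler_wpM2r (ltW (n0 _ N0)) hC; lra.
  by rewrite mulNr oppr_lt0 mulr_gt0 ?n0// divr_gt0 ?mulr_gt0.
- move=> t; apply: limn_einf_ge_near; near=> N.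
  have N0 : (0 < N)%N by near: N.
  have L1 : 1 <= L N by near: N; exact: near_L.
  have mL0 : 0 < m N * L N by rewrite mulr_gt0// (lt_le_trans ltr01).
  have tN : tail_bound N by near: N; exact: tail.
  apply: lne_div_ge1; rewrite ?oppr_lt0//.
  apply: (le_trans (tN _)); rewrite lee_fin ler_expR.
  (* As C >= 2, this is at least 5 m L, so the exponent is at most -2 m L. *)
  have -> : eps ^+ 2 / 2 * (n N * t N) = 5 * C / 2 * (m N * L N).
    by rewrite /t -/(L N); field; rewrite ?gt_eqF ?n0.
  by rewrite -/(L N); have := ler_wpM2r (ltW mL0) C2; lra.
- apply: limn_esup_le_near; near=> N.
  have N0 : (0 < N)%N by near: N.
  have L1 : 1 <= L N by near: N; exact: near_L.
  (* Makes t / 5 at least m / n = exp(- L). *)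
  have LC : eps ^+ 2 / C <= L N by near: N; exact: near_L.
  rewrite -/(L N); set t := 5 * C / eps ^+ 2 * _ * _.
  have z0 : 0 < n N / m N by rewrite divr_gt0 ?n0.
  have mn0 : 0 < m N / n N by rewrite divr_gt0 ?n0.
  have L0 : 0 < L N := lt_le_trans ltr01 L1.
  have C5 : 0 < 5 * C / eps ^+ 2 by rewrite divr_gt0 ?mulr_gt0.
  have t0 : 0 < t := mulr_gt0 (mulr_gt0 C5 mn0) L0.
  have tN : tail_bound N by near: N; exact: tail.
  have mL : L N <= m N * L N by rewrite ler_peMl// (le_trans ler01).
  (* Splitting the error at 4t/5 leaves t/5 for the tail: the exponent is at most 3 m L - 4 m L = -
     m L <= - L. *)
  have hP : expR (3 * (m N * L N) - eps ^+ 2 / 2 * (n N * (4 / 5 * t))) <= t / 5.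
    apply: (@le_trans _ _ (expR (- L N))).
      rewrite ler_expR.
      have -> : eps ^+ 2 / 2 * (n N * (4 / 5 * t)) = 2 * C * (m N * L N).
        by rewrite /t; field; rewrite ?gt_eqF ?n0.
      have mL0 : 0 <= m N * L N by rewrite (le_trans _ mL)// (le_trans ler01).
      by have := ler_wpM2r mL0 C2; lra.
    rewrite expRN lnK ?posrE// invf_div.
    have -> : t / 5 = m N / n N * (C / eps ^+ 2 * L N).
      by rewrite /t; field; rewrite ?gt_eqF ?n0.
    rewrite ler_peMr ?(ltW mn0)//.
    rewrite mulrAC ler_pdivlMr// mul1r mulrC -ler_pdivrMr//.
  rewrite inver gt_eqF// lee_pdivrMr// mul1e.
  have err01 w : 0 <= err N w <= 1 by rewrite link_error_ge0 link_error_le1.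
  have a0 : 0 <= 4 / 5 * t by rewrite mulr_ge0 ?(ltW t0).
  apply: le_trans (expectation_le_tail (P N) (merr N) err01 a0) _.
  apply: (@le_trans _ _ ((4 / 5 * t)%:E + (t / 5)%:E)%E).
    by rewrite leeD2l// (le_trans (tN _))// lee_fin.
  by rewrite -EFinD lee_fin; lra.
Unshelve. all: by end_near.
Qed.
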